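(* Let $K\ge 1$ be an integer and $0<p<1$, and let $q_n$, $U_n$ and the transition matrices $M_n$ on $\{0,\dots,K\}$ be as defined in the context. Let $q^*=q^*(p)=\lim_{n\to\infty}q_n$, the minimal solution in $(p,1)$ of the equation $q=F(q)$ given in the context. Then the nonhomogeneous Markov chain $(B_n)_{n\ge 0}$ on $\{0,\dots,K\}$ with $B_0=0$ and transition matrix $M_n$ from time $n-1$ to time $n$ (so that $\pi^n=\pi^{n-1}M_n$, $\pi^n_k=\mathbb P(B_n=k)$) is strongly ergodic with limit $\pi=(\pi_0,\dots,\pi_K)$, i.e. for all $m\ge 1$, $$\lim_{n\to\infty}\ \sup_{\eta}\ d_{TV}\big(\eta M_m M_{m+1}\cdots M_n,\pi\big)=0,$$ where the supremum is over all probability distributions $\eta$ on $\{0,\dots,K\}$, $d_{TV}$ is total variation distance, and $\pi$ is the probability distribution $$\pi_k=b^k\pi_0,\quad 0\le k\le K-1,\qquad \pi_K=(1-p)b^K\pi_0,$$ with $$\pi_0=\frac{1-q^*}{1-p},\qquad b=\frac{p(1-U^* )}{(1-p)U^*},\qquad U^*=\frac{V_T(q^* )}{q^*}.$$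
   Context: Fix parameters $T>0$, $\mu>0$, $\sigma^2\ge 0$, $\kappa\ge 0$, $\delta>1$, $w>0$. The coverage probability function is $$V_T(q)=\int_0^\infty q\,\exp\Big\{-\frac{\mu T\sigma^2(\kappa+v^\delta)}{1+\kappa}-q\int_v^\infty\frac{wT(\kappa+v^\delta)}{\kappa+u^\delta+T(\kappa+v^\delta)}\,du\Big\}e^{-v}\,dv,$$ and $U(q)=V_T(q)/q$. Fix an integer $K\ge1$ (buffer size) and $0<p<1$ (data rate). Define recursively, starting from $q_0=p$: for $n\ge 0$, $$U_n=\frac{V_T(q_n)}{q_n},\quad b_n=\frac{p(1-U_n)}{(1-p)U_n},\quad \nu^n_0=\frac{1-b_n}{1-(p+b_n-pb_n)b_n^K},\quad q_{n+1}=1-(1-p)\nu^n_0 ,$$ where the expression for $\nu_0^n$ is understood by continuity (value $1/(K+1-p)$) if $b_n=1$. For $n\ge1$ let $M_n=(m^n_{ij})_{0\le i,j\le K}$ be the tridiagonal stochastic matrix with $m^n_{i,i+1}=\beta_i(n)$ for $0\le i\le K-1$, $m^n_{i,i-1}=\delta_i(n)$ for $1\le i\le K$, $m^n_{ii}=1-\beta_i(n)-\delta_i(n)$ for $0\le i\le K$, and all other entries $0$, where $\beta_k(n)=p(1-U_n)$ for $0\le k\le K-1$, $\beta_K(n)=0$, $\delta_0(n)=0$, $\delta_k(n)=(1-p)U_n$ for $1\le k\le K-1$, and $\delta_K(n)=U_n$. The function $F$ is $F(q)=1-G(U(q))$, $p\le q\le 1$, with $$G(u)=\frac{u-p}{u-p\big(\frac{p(1-u)}{(1-p)u}\big)^K}$$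 (understood by continuity, with value $(1-p)/(K+1-p)$, at $u=p$). The sequence $(q_n)$ satisfies $q_n=F(q_{n-1})$ and converges to the minimal solution $q^*\in(p,1)$ of $q=F(q)$. *)

(* Defs.v *)
From HB Require Import structures.
From mathcomp Require Import all_boot all_order all_algebra.
From mathcomp Require Import all_classical all_reals all_analysis.

Set Implicit Arguments.
Unset Strict Implicit.
Unset Printing Implicit Defensive.

Import Order.TTheory GRing.Theory Num.Theory.
Import numFieldNormedType.Exports.

Local Open Scope classical_set_scope.
Local Open Scope ring_scope.

(* [sigma2] is the noise power sigma^2; [v `^ delta] is the real power.
   The inner integrand is O(u^(-delta)) at infinity, so its (real-valued)
   integral is finite as soon as delta > 1. *)
Definition coverage_inner (R : realType) (T kappa delta w v : R) : R :=
  \int[lebesgue_measure]_(u in `[v, +oo[)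
    (w * T * (kappa + v `^ delta) /
       (kappa + u `^ delta + T * (kappa + v `^ delta))).

Definition coverage (R : realType) (T mu sigma2 kappa delta w q : R) : R :=
  \int[lebesgue_measure]_(v in `[0, +oo[)
    (q * expR (- (mu * T * sigma2 * (kappa + v `^ delta) / (1 + kappa))
               - q * coverage_inner T kappa delta w v)
       * expR (- v)).

Definition cond_coverage (R : realType) (T mu sigma2 kappa delta w q : R) : R :=
  coverage T mu sigma2 kappa delta w q / q.

Definition rate_ratio (R : realType) (p u : R) : R :=
  (p * (1 - u)) / ((1 - p) * u).

(* The first branch is the continuous extension at b = 1. *)
Definition empty_prob (R : realType) (K : nat) (p b : R) : R :=
  if b == 1 then (K%:R + 1 - p)^-1
  else (1 - b) / (1 - (p + b - p * b) * b ^+ K).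

Fixpoint activity (R : realType) (K : nat) (p : R) (U : R -> R) (n : nat) : R :=
  if n is m.+1
  then 1 - (1 - p) * empty_prob K p (rate_ratio p (U (activity K p U m)))
  else p.

(* The first branch is the continuous extension at u = p. *)
Definition Gfun (R : realType) (K : nat) (p u : R) : R :=
  if u == p then (1 - p) / (K%:R + 1 - p)
  else (u - p) / (u - p * rate_ratio p u ^+ K).

Definition Ffun (R : realType) (K : nat) (p : R) (U : R -> R) (q : R) : R :=
  1 - Gfun K p (U q).

Definition minimal_fixpoint (R : realType) (f : R -> R) (a b q : R) : Prop :=
  [/\ a < q < b, q = f q & forall s, a < s < b -> s = f s -> q <= s].

Definition up_rate (R : realType) (K : nat) (p u : R) (k : nat) : R :=
  if (k < K)%N then p * (1 - u) else 0.

Definition down_rate (R : realType) (K : nat) (p u : R) (k : nat) : R :=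
  if k == 0%N then 0 else if (k < K)%N then (1 - p) * u else u.

Definition buffer_matrix (R : realType) (K : nat) (p u : R) : 'M[R]_K.+1 :=
  \matrix_(i < K.+1, j < K.+1)
    if j == i.+1 :> nat then up_rate K p u i
    else if i == j.+1 :> nat then down_rate K p u i
    else if i == j then 1 - up_rate K p u i - down_rate K p u i
    else 0.

Definition buffer_trans (R : realType) (K : nat) (p : R) (U : R -> R) (n : nat)
    : 'M[R]_K.+1 :=
  buffer_matrix K p (U (activity K p U n)).

Definition buffer_limit (R : realType) (K : nat) (p : R) (U : R -> R) (q : R)
    : 'rV[R]_K.+1 :=
  let b := rate_ratio p (U q) in
  let pi0 := (1 - q) / (1 - p) in
  \row_(k < K.+1) if (k < K)%N then b ^+ k * pi0 else (1 - p) * b ^+ K * pi0.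

Definition is_distribution (R : realType) (K : nat) (eta : 'rV[R]_K.+1) : Prop :=
  (forall k, 0 <= eta 0 k) /\ \sum_k eta 0 k = 1.

Definition is_stochastic (R : realType) (K : nat) (M : 'M[R]_K.+1) : Prop :=
  forall i, is_distribution (row i M).

Definition dTV (R : realType) (K : nat) (eta pi : 'rV[R]_K.+1) : R :=
  \big[Num.max/0]_(A : {set 'I_K.+1})
    `| \sum_(k in A) eta 0 k - \sum_(k in A) pi 0 k |.

(* [M n] is the transition matrix from time n.-1 to time n; the product is
   the ordered product M_m M_(m+1) ... M_n of the matrix ring. *)
Definition strongly_ergodic (R : realType) (K : nat) (M : nat -> 'M[R]_K.+1)
    (pi : 'rV[R]_K.+1) : Prop :=
  forall m, (1 <= m)%N ->
    sup [set dTV (eta *m \prod_(m <= i < n.+1) M i) pi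
        | eta in [set eta : 'rV[R]_K.+1 | is_distribution eta]]
      @[n --> \oo] --> (0 : R).

(* The Markov property is stated in product form, which is the usual
   conditional-probability form whenever the history has positive mass. *)
Definition is_markov_chain (R : realType) (K : nat) (d : measure_display)
    (Omega : measurableType d) (P : probability Omega R)
    (B : nat -> Omega -> 'I_K.+1) (x0 : 'I_K.+1) (M : nat -> 'M[R]_K.+1)
    : Prop :=
  [/\ forall n k, measurable (B n @^-1` [set k]),
      P (B 0%N @^-1` [set x0]) = 1%E
    & forall (n : nat) (x : nat -> 'I_K.+1),
        P [set o | forall i, (i <= n.+1)%N -> B i o = x i] =
        (P [set o | forall i, (i <= n)%N -> B i o = x i]
           * (M n.+1 (x n) (x n.+1))%:E)%E].

Definition law (R : realType) (K : nat) (d : measure_display)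
    (Omega : measurableType d) (P : probability Omega R) (X : Omega -> 'I_K.+1)
    : 'rV[R]_K.+1 :=
  \row_k fine (P (X @^-1` [set k])).

(* Main.v *)
Require Import Defs.
From HB Require Import structures.
From mathcomp Require Import all_boot all_order all_algebra.
From mathcomp Require Import all_classical all_reals all_analysis.
From mathcomp Require Import measurable_realfun zify ring lra.

Import Order.TTheory GRing.Theory Num.Theory.
Import numFieldNormedType.Exports.

Local Open Scope classical_set_scope.
Local Open Scope ring_scope.

(** The conditional coverage probability is
      [U q = \int_(v >= 0) exp (- c v - q * I v) * exp (- v)]
    with [c v >= 0] and [0 < I v < +oo] for [v > 0].  Hence [0 < U q < 1] for
    [q > 0] ([cond_coverage_gt0], [cond_coverage_lt1]), [U] is nonincreasing, and
    the inequality [x * exp (- x) <= 1] gives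
    [U q <= U r + (r - q) / q] for [0 < q <= r] ([cond_coverage_lip]), so that
    [U] is continuous.

    Put [b = rate_ratio p u] and [S b = \sum_(i < K) b ^+ i + (1 - p) * b ^+ K].
    The empty-buffer probability is [1 / S b] and [G u = (1 - p) / S b], so the
    recursion reads [q n.+1 = F (q n)] with [F q = 1 - (1 - p) / S (b (U q))].  As
    [S] is nondecreasing and larger than [1], while [b] and [U] are nonincreasing,
    [F] is a nondecreasing map into the open interval from [p] to [1].  The
    iterates from [p] therefore increase, their limit is a fixed point by
    continuity, and it lies below every fixed point in that interval
    ([activity_lim_minimal]).

    The fixed-point equation says that [(1 - q) / (1 - p)] is the normalization
    [1 / S b] of the law [pi], and [pi] is reversible for the limit matrix
    ([buffer_detailed_balance]).  Since [U (q n)] converges to [U qstar], the law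
    [pi] is asymptotically invariant under [M n].  On the other hand
    [U (q n) >= U 1], so within [K] steps every state reaches [0] with a
    probability bounded below uniformly in time ([prod_minor]); by Doeblin's
    argument each block of [K] matrices contracts the l1 norm of zero-mass vectors
    by a fixed factor ([l1norm_doeblin]).  A contraction perturbed by a vanishing
    defect forces convergence ([cvg0_delayed_contraction]), uniformly in the
    initial law ([strongly_ergodic_minorized]).  The evolution equation of the
    laws of the chain follows by summing the product form of the Markov property
    over the past ([law_step]). *)

(** * Positivity and integrability on the real line *)

(** A nonnegative function with vanishing integral is zero almost everywhere,
    which is impossible on [E].  All the strict inequalities on the coverage
    probability below come from this fact. *)
Lemma Rintegral_gt0 d (T : measurableType d) (R : realType)
    (mu : {measure set T -> \bar R}) (D E : set T) (f : T -> R) :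
  measurable D -> measurable E -> E `<=` D -> (0 < mu E)%E ->
  mu.-integrable D (EFin \o f) -> (forall x, D x -> 0 <= f x) ->
  (forall x, E x -> 0 < f x) -> 0 < \int[mu]_(x in D) f x.
Proof.
move=> mD mE ED muE fi f0 fE; rewrite lt0r Rintegral_ge0// andbT.
apply/negP => /eqP i0.
have fin : (\int[mu]_(x in D) (f x)%:E)%E \is a fin_num.
  exact: integrable_fin_num.
have : (\int[mu]_(x in D) `|(f x)%:E| = 0)%E.
  rewrite -[RHS](congr1 EFin i0) /Rintegral fineK//.
  by apply: eq_integral => x /[!inE] Dx; rewrite gee0_abs// lee_fin f0.
move=> /(ae_eq_integral_abs mu mD (measurable_int _ fi)) [N [mN N0 DN]].
have : (mu E <= mu N)%E.
  apply: le_measure; rewrite ?inE// => x Ex; apply: DN => /= /(_ (ED _ Ex)) [fx0].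
  by have := fE _ Ex; rewrite fx0 ltxx.
by rewrite N0 leNgt muE.
Qed.

Lemma powR_cvgy0 (R : realType) (s : R) : 0 < s ->
  x `^ (- s) @[x --> +oo] --> (0 : R).
Proof.
move=> s0; apply/cvgrPdist_le => /= e e0; near=> x.
have x0 : 0 < x by near: x; exact: nbhs_pinfty_gt.
rewrite sub0r normrN ger0_norm ?powR_ge0// powRN.
rewrite invf_ple ?posrE ?powR_gt0//.
have xe : (e^-1) `^ s^-1 <= x by near: x; apply: nbhs_pinfty_ge; exact: num_real.
apply: le_trans (ge0_ler_powR (ltW s0) _ _ xe); rewrite ?nnegrE ?powR_ge0 ?(ltW x0)//.
by rewrite -powRrM mulVf ?gt_eqF// powRr1 ?invr_ge0 ?(ltW e0).
Unshelve. all: by end_near. Qed.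

(** The antiderivative [x `^ (1 - s) / (1 - s)] vanishes at infinity. *)
Lemma integrable_powR_itvcy (R : realType) (a s : R) : 0 < a -> 1 < s ->
  (@lebesgue_measure R).-integrable `[a, +oo[ (EFin \o (fun x => x `^ (- s))).
Proof.
move=> a0 s1.
have d1 (x : R) : 0 < x -> derivable (fun y : R => y `^ (1 - s)) x 1.
  by move=> x0; apply: derivable_powR; rewrite in_itv/= x0.
have d2 (x : R) : 0 < x -> derivable (fun y : R => y `^ (- s)) x 1.
  by move=> x0; apply: derivable_powR; rewrite in_itv/= x0.
have s10 : 1 - s != 0 by rewrite lt_eqF// subr_lt0.
have mf : measurable_fun `[a, +oo[ (fun x : R => x `^ (- s)).
  by apply: measurable_funTS; exact: measurable_powR.
apply/integrableP; split; first exact/measurable_EFinP.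
under eq_integral do rewrite /= ger0_norm ?powR_ge0//.
rewrite (@ge0_continuous_FTC2y _ _ (fun x => (1 - s)^-1 * x `^ (1 - s)) a 0).
- by rewrite sub0e -EFinN ltry.
- by move=> x _; exact: powR_ge0.
- apply: derivable_within_continuous => x.
  by rewrite in_itv/= andbT => ax; apply: d2; exact: lt_le_trans ax.
- rewrite -[X in _ --> X](mulr0 (1 - s)^-1); apply: cvgMr.
  by rewrite -opprB; apply: powR_cvgy0; rewrite subr_gt0.
- move=> x ax; apply: derivableM => //; apply: d1; exact: lt_trans ax.
- apply: cvgMr; apply: cvg_at_right_filter.
  have /derivable1_diffP/differentiable_continuous := d1 _ a0; exact.
- move=> x; rewrite in_itv/= andbT => ax.
  have x0 := lt_trans a0 ax.
  rewrite derive1Ml; last exact: d1.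
  rewrite powR_derive1 ?in_itv/= ?x0//.
  by rewrite mulrA mulVf// mul1r addrAC subrr add0r.
Qed.

Lemma lebesgue_measure_unit_itv (R : realType) (v : R) :
  (0 < @lebesgue_measure R [set` `[v, (v + 1)%R]])%E.
Proof.
rewrite lebesgue_measure_itv/= lte_fin ltrDl ltr01.
by rewrite -EFinB lte_fin addrAC subrr add0r.
Qed.

(** * The interference integral *)

Section Kernel.
Variables (R : realType) (T kappa delta w : R).
Hypotheses (T0 : 0 < T) (kappa0 : 0 <= kappa) (delta1 : 1 < delta) (w0 : 0 < w).

Definition interference (v u : R) : R :=
  w * T * (kappa + v `^ delta) / (kappa + u `^ delta + T * (kappa + v `^ delta)).

Let den_ge0 v u : 0 <= kappa + u `^ delta + T * (kappa + v `^ delta).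
Proof. by rewrite ?addr_ge0 ?mulr_ge0 ?addr_ge0 ?powR_ge0 ?(ltW T0). Qed.

Lemma interference_ge0 v u : 0 <= interference v u.
Proof.
by rewrite /interference divr_ge0// !mulr_ge0 ?addr_ge0 ?powR_ge0 ?(ltW T0) ?(ltW w0).
Qed.

Lemma interference_gt0 v u : 0 < v -> 0 < interference v u.
Proof.
move=> v0; have a0 : 0 < kappa + v `^ delta by rewrite ltr_wpDl ?powR_gt0.
by rewrite divr_gt0 ?ltr_wpDl ?addr_ge0 ?powR_ge0// !mulr_gt0.
Qed.

Lemma measurable_interference :
  measurable_fun [set: R * R] (fun z : R * R => interference z.1 z.2).
Proof.
rewrite /interference.
(* Inversion of a nonnegative number is a real power, hence measurable. *)
under eq_fun do rewrite -powR_inv1//.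
have mp (i : R * R -> R) : measurable_fun setT i ->
    measurable_fun setT (fun z => kappa + i z `^ delta).
  move=> mi; apply: measurable_funD => //.
  exact: (measurableT_comp (measurable_powR delta)).
apply: measurable_funM; first by apply: measurable_funM => //; exact: mp.
apply: (measurableT_comp (measurable_powR (-1))) => //.
by apply: measurable_funD; [exact: mp|apply: measurable_funM => //; exact: mp].
Qed.

(** The variable [v] also enters through the domain of integration; extending
    the integrand by zero below the diagonal [u = v] makes this a section
    integral of one nonnegative function of two variables, and measurability
    is then part of Tonelli's theorem. *)
Lemma measurable_coverage_inner :
  measurable_fun setT (coverage_inner T kappa delta w).
Proof.
pose f (z : R * R) : \bar R := (if z.1 <= z.2 then interference z.1 z.2 else 0)%:E.
have mf : measurable_fun setT f.
  apply/measurable_EFinP; apply: measurable_fun_ifT => //.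
    exact: measurable_fun_ler.
  exact: measurable_interference.
have f0 z : (0 <= f z)%E by rewrite lee_fin; case: ifP => // _; exact: interference_ge0.
have := @measurable_fun_fubini_tonelli_F _ _ _ _ _ (@lebesgue_measure R) f mf f0.
move=> mF.
rewrite [coverage_inner _ _ _ _](_ : _ = fine \o fubini_F (@lebesgue_measure R) f).
  exact: measurableT_comp.
apply/funext => v; rewrite /coverage_inner /Rintegral/= integral_mkcond.
congr fine; apply: eq_integral => u _; rewrite /f patchE mem_setE in_itv/= andbT.
by case: ifP.
Qed.

(** Bounding the denominator from below by [u `^ delta] gives a tail of order
    [u `^ (- delta)]; this is where [delta > 1] is needed. *)
Lemma integrable_interference v : 0 < v ->
  (@lebesgue_measure R).-integrable `[v, +oo[ (EFin \o interference v).
Proof.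
move=> v0.
have ip := integrable_powR_itvcy _ v delta v0 delta1.
set a := w * T * (kappa + v `^ delta).
apply: (@le_integrable _ _ R (@lebesgue_measure R) `[v, +oo[%classic _
  (EFin \o interference v) (EFin \o (fun u => a * u `^ (- delta)))) => //.
- apply/measurable_EFinP; apply: measurable_funTS.
  exact: (measurableT_comp measurable_interference (pair1_measurable v)).
- move=> u; rewrite /= in_itv/= andbT => vu.
  have u0 := lt_le_trans v0 vu.
  have a0 : 0 <= a by rewrite /a !mulr_ge0 ?addr_ge0 ?powR_ge0 ?(ltW T0) ?(ltW w0).
  rewrite lee_fin !ger0_norm ?interference_ge0 ?(mulr_ge0 a0) ?powR_ge0//.
  rewrite /interference -/a ler_wpM2l// powRN lef_pV2 ?posrE ?powR_gt0//.
    rewrite [kappa + _]addrC -addrA lerDl.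
    by rewrite ?addr_ge0 ?mulr_ge0 ?addr_ge0 ?powR_ge0 ?(ltW T0).
  by rewrite ltr_wpDr ?mulr_ge0 ?addr_ge0 ?powR_ge0 ?(ltW T0)// ltr_wpDl ?powR_gt0.
- by have := @integrableZl _ _ R (@lebesgue_measure R) `[v, +oo[%classic
    ltac:(done) a _ ip.
Qed.

Lemma coverage_inner_ge0 v : 0 <= coverage_inner T kappa delta w v.
Proof. by apply: Rintegral_ge0 => u _; exact: interference_ge0. Qed.

(** Without the finiteness of the integral the real-valued integral would be
    zero by convention, so positivity does rest on [delta > 1]. *)
Lemma coverage_inner_gt0 v : 0 < v -> 0 < coverage_inner T kappa delta w v.
Proof.
move=> v0; apply: (@Rintegral_gt0 _ _ R (@lebesgue_measure R) `[v, +oo[%classic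
  `[v, v + 1]%classic) => //.
- by move=> u; rewrite /= !in_itv/= andbT => /andP[].
- exact: lebesgue_measure_unit_itv.
- exact: integrable_interference.
- by move=> u _; exact: interference_ge0.
- by move=> u _; exact: interference_gt0.
Qed.
End Kernel.

(** * The conditional coverage probability *)

Section ExpDensity.
Variable R : realType.
Notation leb := (@lebesgue_measure R).

Lemma exponential_pdf1E (x : R) :
  exponential_pdf 1 x = ((fun y : R => expR (- y)) \_ `[0, +oo[) x.
Proof. by rewrite /exponential_pdf !patchE; case: ifP => // _; rewrite mul1r mulN1r. Qed.

Lemma integrable_expRN :
  leb.-integrable `[0, +oo[ (EFin \o (fun v : R => expR (- v))).
Proof.
have h := integrable_exponential_pdf (@ltr01 R).
apply/integrable_mkcond => //.
rewrite restrict_EFin.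
rewrite (_ : (fun v : R => expR (- v)) \_ `[0, +oo[ = exponential_pdf 1)//.
by apply/funext => x; rewrite exponential_pdf1E.
Qed.

Lemma Rintegral_expRN : \int[leb]_(v in `[0, +oo[) expR (- v) = 1.
Proof.
rewrite Rintegral_mkcond /Rintegral.
rewrite -[RHS](congr1 fine (integral_exponential_pdf (@ltr01 R))).
by congr fine; apply: eq_integral => x _; rewrite exponential_pdf1E.
Qed.
End ExpDensity.

Section Coverage.
Variables (R : realType) (T mu sigma2 kappa delta w : R).
Hypotheses (T0 : 0 < T) (mu0 : 0 < mu) (sigma20 : 0 <= sigma2)
  (kappa0 : 0 <= kappa) (delta1 : 1 < delta) (w0 : 0 < w).
Notation leb := (@lebesgue_measure R).
Notation I := (coverage_inner T kappa delta w).
Notation U := (cond_coverage T mu sigma2 kappa delta w).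

Definition coverage_integrand (q v : R) : R :=
  expR (- (mu * T * sigma2 * (kappa + v `^ delta) / (1 + kappa)) - q * I v)
  * expR (- v).
Notation psi := coverage_integrand.

Let noise_ge0 v : 0 <= mu * T * sigma2 * (kappa + v `^ delta) / (1 + kappa).
Proof.
by rewrite divr_ge0 ?mulr_ge0 ?addr_ge0 ?powR_ge0 ?(ltW T0) ?(ltW mu0).
Qed.

Lemma coverage_integrand_gt0 q v : 0 < psi q v.
Proof. by rewrite mulr_gt0 ?expR_gt0. Qed.

Lemma coverage_integrand_le q v : 0 <= q -> psi q v <= expR (- v).
Proof.
move=> q0; rewrite /psi ler_piMl ?expR_ge0// -[leRHS]expR0 ler_expR.
by rewrite -opprD oppr_le0 addr_ge0 ?noise_ge0 ?(mulr_ge0 q0) ?coverage_inner_ge0.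
Qed.

Lemma coverage_integrand_lt q v : 0 < q -> 0 < v -> psi q v < expR (- v).
Proof.
move=> q0 v0; rewrite /psi gtr_pMl ?expR_gt0// -[ltRHS]expR0 ltr_expR.
by rewrite -opprD oppr_lt0 ltr_wpDl ?noise_ge0 ?(mulr_gt0 q0) ?coverage_inner_gt0.
Qed.

Lemma coverage_integrand_nincr q r v : q <= r -> psi r v <= psi q v.
Proof.
move=> qr; rewrite /psi ler_wpM2r ?expR_ge0// ler_expR lerD2l lerN2.
by rewrite ler_wpM2r ?coverage_inner_ge0.
Qed.

(** With [x = q * I v] one has [r * I v = x + t * x] for [t = (r - q) / q], and
      [exp (- x) - exp (- x - t * x) <= t * x * exp (- x) <= t]
    since [x * exp (- x) <= 1].  The bound does not involve [I v], which is
    unbounded in [v] in general. *)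
Lemma coverage_integrand_lip q r v : 0 < q -> q <= r ->
  psi q v <= psi r v + (r - q) / q * expR (- v).
Proof.
move=> q0 qr; rewrite /psi -mulrDl ler_wpM2r ?expR_ge0//.
have I0 : 0 <= I v by apply: coverage_inner_ge0.
set c := _ / _; have c0 : 0 <= c by exact: noise_ge0.
rewrite !expRD; set E := expR (- c).
have E0 : 0 < E by exact: expR_gt0.
have E1 : E <= 1 by rewrite -[leRHS]expR0 ler_expR oppr_le0.
set x := q * I v; have x0 : 0 <= x by rewrite mulr_ge0// ltW.
have -> : r * I v = x + (r - q) / q * x.
  by rewrite /x; field; rewrite gt_eqF.
set t := (r - q) / q; have t0 : 0 <= t by rewrite divr_ge0 ?subr_ge0// ltW.
rewrite opprD expRD.
have ex0 : 0 < expR (- x) := expR_gt0 _.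
have h1 : 1 - t * x <= expR (- (t * x)) by have := expR_ge1Dx (- (t * x)).
have h2 : x * expR (- x) <= 1.
  rewrite expRN ler_pdivrMr ?expR_gt0// mul1r.
  by apply: le_trans (expR_ge1Dx x); rewrite lerDr.
have h3 : E * expR (- x) * (1 - t * x) <= E * expR (- x) * expR (- (t * x)).
  by rewrite ler_wpM2l// mulr_ge0// ltW.
have Et : E * t <= t by rewrite ler_piMl.
have h4 : E * t * (x * expR (- x)) <= t * 1.
  by apply: ler_pM => //; rewrite mulr_ge0// ltW.
rewrite mulrA.
nra.
Qed.

Lemma measurable_coverage_integrand q : measurable_fun setT (psi q).
Proof.
apply: measurable_funM; last first.
  by apply: measurableT_comp => //.
apply: measurableT_comp => //; apply: measurable_funB.
  apply: measurableT_comp => //; apply: measurable_funM => //.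
  apply: measurable_funM => //; apply: measurable_funD => //.
by apply: measurable_funM => //; exact: measurable_coverage_inner.
Qed.

Lemma integrable_coverage_integrand q : 0 <= q ->
  leb.-integrable `[0, +oo[ (EFin \o psi q).
Proof.
move=> q0; apply: (@le_integrable _ _ R leb `[0, +oo[%classic _ (EFin \o psi q) _ _ _
  (integrable_expRN R)) => //.
  apply/measurable_EFinP; apply: measurable_funTS.
  exact: measurable_coverage_integrand.
move=> v _ /=; rewrite lee_fin !ger0_norm ?expR_ge0 ?coverage_integrand_le//.
by rewrite ltW// coverage_integrand_gt0.
Qed.

Lemma cond_coverageE q : 0 < q -> U q = \int[leb]_(v in `[0, +oo[) psi q v.
Proof.
move=> q0; rewrite /cond_coverage /coverage.
under eq_Rintegral do rewrite -mulrA.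
rewrite RintegralZl//; last exact/integrable_coverage_integrand/ltW.
by rewrite mulrAC divff ?mul1r// gt_eqF.
Qed.

Lemma cond_coverage_gt0 q : 0 < q -> 0 < U q.
Proof.
move=> q0; rewrite cond_coverageE//.
apply: (@Rintegral_gt0 _ _ R leb `[0, +oo[%classic
  `[1, (1 + 1)%R]%classic) => //.
- by move=> u; rewrite /= !in_itv/= andbT => /andP[u1 _]; exact: le_trans u1.
- exact: lebesgue_measure_unit_itv.
- exact/integrable_coverage_integrand/ltW.
- by move=> v _; exact/ltW/coverage_integrand_gt0.
- by move=> v _; exact: coverage_integrand_gt0.
Qed.

Lemma cond_coverage_lt1 q : 0 < q -> U q < 1.
Proof.
move=> q0; rewrite cond_coverageE// -subr_gt0 -(Rintegral_expRN R).
have ip := integrable_coverage_integrand q (ltW q0).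
rewrite -(RintegralB _ (integrable_expRN R) ip)//.
apply: (@Rintegral_gt0 _ _ R leb `[0, +oo[%classic
  `[1, (1 + 1)%R]%classic) => //.
- by move=> u; rewrite /= !in_itv/= andbT => /andP[u1 _]; exact: le_trans u1.
- exact: lebesgue_measure_unit_itv.
- by have := @integrableB _ _ R leb `[0, +oo[%classic ltac:(done) _ _
    (integrable_expRN R) ip.
- by move=> v _; rewrite subr_ge0; apply: coverage_integrand_le; exact: ltW.
- move=> v; rewrite /= in_itv/= => /andP[v1 _].
  by rewrite subr_gt0 coverage_integrand_lt// (lt_le_trans _ v1).
Qed.

Lemma cond_coverage_nincr q r : 0 < q -> q <= r -> U r <= U q.
Proof.
move=> q0 qr; have r0 := lt_le_trans q0 qr.
rewrite !cond_coverageE//; apply: le_Rintegral => //.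
- exact/integrable_coverage_integrand/ltW.
- exact/integrable_coverage_integrand/ltW.
- by move=> v _; exact: coverage_integrand_nincr.
Qed.

(** Together with monotonicity this one-sided bound gives the continuity of the
    conditional coverage probability on the positive reals. *)
Lemma cond_coverage_lip q r : 0 < q -> q <= r -> U q <= U r + (r - q) / q.
Proof.
move=> q0 qr; have r0 := lt_le_trans q0 qr.
have ip := integrable_coverage_integrand r (ltW r0).
have ie := @integrableZl _ _ R leb `[0, +oo[%classic ltac:(done) ((r - q) / q) _
  (integrable_expRN R).
rewrite !cond_coverageE// -[X in _ <= _ + X]mulr1 -(Rintegral_expRN R).
rewrite -RintegralZl//; last exact: integrable_expRN.
rewrite -RintegralD//; apply: le_Rintegral => //.
- exact/integrable_coverage_integrand/ltW.
- by have := @integrableD _ _ R leb `[0, +oo[%classic ltac:(done) _ _ ip ie.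
- by move=> v _; exact: coverage_integrand_lip.
Qed.
End Coverage.

(** * The activity recursion and its limit *)

Section FixedPoint.
Variables (R : realType) (K : nat) (p : R).
Hypotheses (K1 : (1 <= K)%N) (p01 : 0 < p < 1).

Let p0 : 0 < p. Proof. by case/andP: p01. Qed.
Let p1 : 0 < 1 - p. Proof. by rewrite subr_gt0; case/andP: p01. Qed.

(** The inverse of the empty-buffer probability, which is also the normalizing
    constant of the stationary law of the buffer.  It is polynomial in [b], so
    neither [b = 1] nor [u = p] is exceptional in this form. *)
Definition occupancy_sum (b : R) : R := \sum_(i < K) b ^+ i + (1 - p) * b ^+ K.
Notation S := occupancy_sum.

(** Since [p + b - p * b = 1 - (1 - p) * (1 - b)], the denominator of
    [empty_prob] factors as [1 - b] times [occupancy_sum]. *)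
Lemma empty_probE b : empty_prob K p b = (S b)^-1.
Proof.
rewrite /empty_prob /S; case: eqP => [->|/eqP b1].
  congr (_^-1); rewrite expr1n mulr1 addrA.
  by under eq_bigr do rewrite expr1n; rewrite sumr_const card_ord.
have b1' : 1 - b != 0 by rewrite subr_eq0 eq_sym.
have -> : 1 - (p + b - p * b) * b ^+ K =
    (1 - b) * (\sum_(i < K) b ^+ i + (1 - p) * b ^+ K).
  have := subrX1 b K; set s := \sum_(i < K) _ => e.
  have -> : (1 - b) * (s + (1 - p) * b ^+ K) =
    - ((b - 1) * s) + (1 - b) * (1 - p) * b ^+ K by ring.
  by rewrite -e; ring.
by rewrite invfM mulrA divff// mul1r.
Qed.

Lemma occupancy_sum_gt1 b : 0 < b -> 1 < S b.
Proof.
move=> b0; rewrite /S -(prednK K1) big_ord_recl expr0 -addrA ltrDl.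
rewrite ltr_wpDl ?mulr_gt0 ?exprn_gt0// sumr_ge0// => i _.
by rewrite exprn_ge0// ltW.
Qed.

Lemma occupancy_sum_ndecr b c : 0 < b -> b <= c -> S b <= S c.
Proof.
move=> b0 bc; have h n : b ^+ n <= c ^+ n.
  by apply: lerXn2r; rewrite ?nnegrE ?(ltW b0)// (le_trans (ltW b0)).
by rewrite /S lerD ?ler_wpM2l ?(ltW p1)// ler_sum.
Qed.

Lemma rate_ratio_gt0 u : 0 < u < 1 -> 0 < rate_ratio p u.
Proof.
move=> /andP[u0 u1]; rewrite /rate_ratio divr_gt0// mulr_gt0//.
by rewrite subr_gt0.
Qed.

Lemma rate_ratio_nincr u v : 0 < u -> u <= v -> v < 1 ->
  rate_ratio p v <= rate_ratio p u.
Proof.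
move=> u0 uv v1; have v0 := lt_le_trans u0 uv.
have pu x : 0 < x -> 0 < (1 - p) * x by move=> x0; rewrite mulr_gt0.
rewrite /rate_ratio ler_pdivrMr ?pu// mulrAC ler_pdivlMr ?pu//.
rewrite -!mulrA ler_pM2l// !(mulrCA _ (1 - p)) ler_pM2l//.
nra.
Qed.

(** The key identities are [1 - b = (u - p) / ((1 - p) * u)] and
    [p + b - p * b = p / u] for [b = rate_ratio p u]; the exceptional cases
    [u = p] and [b = 1] coincide by the first one. *)
Lemma Gfun_empty_prob u : 0 < u < 1 ->
  Gfun K p u = (1 - p) * empty_prob K p (rate_ratio p u).
Proof.
move=> /andP[u0 u1]; rewrite /Gfun /empty_prob.
have un0 : u != 0 by rewrite gt_eqF.
have pn0 : 1 - p != 0 by rewrite gt_eqF.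
have bE : 1 - rate_ratio p u = (u - p) / ((1 - p) * u).
  by rewrite /rate_ratio; field; rewrite un0.
rewrite -[rate_ratio p u == 1]subr_eq0 -oppr_eq0 opprB bE.
rewrite mulf_eq0 invr_eq0 mulf_eq0 (negPf un0) (negPf pn0) !orbF subr_eq0.
case: ifP => // up; set B := rate_ratio p u ^+ K.
have -> : p + rate_ratio p u - p * rate_ratio p u = p / u.
  by rewrite /rate_ratio; field; rewrite un0.
have -> : u - p * B = u * (1 - p / u * B) by field.
rewrite !invfM !mulrA; congr (_ * _).
by field; rewrite un0.
Qed.

(** The rest of the section uses of the conditional coverage probability only
    its range, its monotonicity and its one-sided Lipschitz bound. *)
Variable U : R -> R.
Hypotheses (U01 : forall q, 0 < q -> 0 < U q < 1)
  (Unincr : forall q r, 0 < q -> q <= r -> U r <= U q)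
  (Ulip : forall q r, 0 < q -> q <= r -> U q <= U r + (r - q) / q).
Notation F := (Ffun K p U).
Notation q := (activity K p U).

Lemma FfunE x : 0 < x -> F x = 1 - (1 - p) / S (rate_ratio p (U x)).
Proof. by move=> x0; rewrite /Ffun Gfun_empty_prob ?U01// empty_probE. Qed.

Lemma Ffun_bounds x : 0 < x -> p < F x < 1.
Proof.
move=> x0; rewrite FfunE//; have b0 := rate_ratio_gt0 _ (U01 _ x0).
have s1 := occupancy_sum_gt1 _ b0; have s0 := lt_trans ltr01 s1.
rewrite gtrBl divr_gt0// andbT ltrBrDl -ltrBrDr ltr_pdivrMr//.
by rewrite ltr_pMr.
Qed.

Lemma Ffun_ndecr x y : 0 < x -> x <= y -> F x <= F y.
Proof.
move=> x0 xy; have y0 := lt_le_trans x0 xy; rewrite !FfunE//.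
have b0 := rate_ratio_gt0 _ (U01 _ x0).
have bb : rate_ratio p (U x) <= rate_ratio p (U y).
  apply: rate_ratio_nincr; [by case/andP: (U01 _ y0)|exact: Unincr|].
  by case/andP: (U01 _ x0).
have s1 := occupancy_sum_gt1 _ b0; have s0 := lt_trans ltr01 s1.
have ss := occupancy_sum_ndecr _ _ b0 bb.
by rewrite lerB// ler_pM2l// lef_pV2 ?posrE// (lt_le_trans s0).
Qed.

Lemma activity_bounds n : p <= q n < 1.
Proof.
elim: n => [|n /andP[pq _]]; first by rewrite /= lexx; case/andP: p01.
have q0 := lt_le_trans p0 pq.
have := Ffun_bounds _ q0; rewrite /Ffun Gfun_empty_prob ?U01// => /andP[h1 h2].
by rewrite /= h2 (ltW h1).
Qed.

Lemma activity_gt0 n : 0 < q n.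
Proof. by case/andP: (activity_bounds n) => /(lt_le_trans p0). Qed.

Lemma activityS n : q n.+1 = F (q n).
Proof. by rewrite /= -Gfun_empty_prob// U01// activity_gt0. Qed.

Lemma activity_ndecr : nondecreasing_seq q.
Proof.
apply/nondecreasing_seqP; elim=> [|n IH].
  by case/andP: (activity_bounds 1).
rewrite (activityS n.+1) [leLHS]activityS.
exact: Ffun_ndecr (activity_gt0 n) IH.
Qed.

Lemma activity_cvg : q n @[n --> \oo] --> lim (q n @[n --> \oo]).
Proof.
apply: nondecreasing_is_cvgn; first exact: activity_ndecr.
by exists 1 => _ [n _ <-]; case/andP: (activity_bounds n) => _ /ltW.
Qed.
Notation qstar := (lim (q n @[n --> \oo])).

Lemma activity_le_lim n : q n <= qstar.
Proof.
by apply: nondecreasing_cvgn_le; [exact: activity_ndecr|exact: activity_cvg].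
Qed.

Lemma activity_lim_gt : p < qstar.
Proof.
apply: lt_le_trans (activity_le_lim 1); rewrite activityS.
by case/andP: (Ffun_bounds _ (activity_gt0 0)).
Qed.

Let qstar0 : 0 < qstar. Proof. exact: lt_trans activity_lim_gt. Qed.

(** As [q n] increases to its limit, [U (q n)] is squeezed between [U qstar] and
    [U qstar + (qstar - q n) / p]. *)
Lemma cond_activity_cvg : U (q n) @[n --> \oo] --> U qstar.
Proof.
apply: (@squeeze_cvgr _ _ _ _ (fun=> U qstar)
  (fun n => U qstar + (qstar - q n) / p)).
- near=> n; rewrite Unincr ?activity_gt0 ?activity_le_lim//=.
  apply: le_trans (Ulip _ _ (activity_gt0 n) (activity_le_lim n)) _.
  rewrite lerD2l ler_wpM2l ?subr_ge0 ?activity_le_lim//.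
  by rewrite lef_pV2 ?posrE ?activity_gt0//; case/andP: (activity_bounds n).
- exact: cvg_cst.
- rewrite -[X in _ --> X]addr0 -[X in _ --> _ + X](mul0r p^-1).
  apply: cvgD; first exact: cvg_cst.
  apply: cvgMl; rewrite -(subrr qstar).
  by apply: cvgB; [exact: cvg_cst|exact: activity_cvg].
Unshelve. all: by end_near. Qed.

Lemma rate_ratio_cvg (u : nat -> R) (l : R) : l != 0 ->
  u n @[n --> \oo] --> l -> rate_ratio p (u n) @[n --> \oo] --> rate_ratio p l.
Proof.
move=> l0 ul; apply: cvgM.
  by apply: cvgMr; apply: cvgB => //; exact: cvg_cst.
apply: cvgV; first by rewrite mulf_neq0// gt_eqF.
exact: cvgMr.
Qed.

Lemma occupancy_sum_continuous : continuous S.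
Proof.
move=> b; rewrite /S; apply: cvgD.
  by apply: cvg_big => [|i _]; [exact: add_continuous|exact: exprn_continuous].
by apply: cvgMr; exact: exprn_continuous.
Qed.

Lemma activity_lim_fixpoint : qstar = F qstar.
Proof.
have h : q n.+1 @[n --> \oo] --> F qstar.
  under eq_fun do rewrite activityS FfunE ?activity_gt0//.
  rewrite FfunE//; apply: cvgB; first exact: cvg_cst.
  have b0 := rate_ratio_gt0 _ (U01 _ qstar0).
  apply: cvgMr; apply: cvgV.
    by rewrite gt_eqF// (lt_trans ltr01)// occupancy_sum_gt1.
  apply: continuous_cvg; first exact: occupancy_sum_continuous.
  apply: rate_ratio_cvg; last exact: cond_activity_cvg.
  by rewrite gt_eqF//; case/andP: (U01 _ qstar0).
apply: (@cvg_unique _ (@Rhausdorff R) _ _ _ _ _ h).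
by have := activity_cvg; rewrite -(cvg_shiftS q).
Qed.

(** A fixed point [s > p] of the nondecreasing map [F] is an upper bound of the
    iterates of [F] started at [p], hence of their limit. *)
Lemma activity_lim_minimal : minimal_fixpoint F p 1 qstar.
Proof.
split; [|exact: activity_lim_fixpoint|].
  rewrite activity_lim_gt activity_lim_fixpoint.
  by case/andP: (Ffun_bounds _ qstar0).
move=> s /andP[ps s1] sF.
apply: limr_le; first exact: activity_cvg.
apply: nearW; elim=> [|n IH]; first exact: ltW.
by rewrite activityS sF Ffun_ndecr ?activity_gt0.
Qed.

Lemma empty_prob_lim : (1 - qstar) / (1 - p) = (S (rate_ratio p (U qstar)))^-1.
Proof.
rewrite {1}activity_lim_fixpoint FfunE// opprB addrC subrK.
by rewrite mulrAC divff ?mul1r// gt_eqF.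
Qed.

End FixedPoint.

Arguments occupancy_sum {R} K p b.

(** * Products of stochastic matrices *)

(** An eventual bound [a <= r ^+ j * C + eps / 2] improves to the same bound with
    [j.+1] once [e] is below [(1 - r) * (eps / 2)], because [eps / 2] is the
    fixed point of [x |-> r * x + (1 - r) * (eps / 2)]. *)
Lemma cvg0_delayed_contraction (R : realType) (N0 K : nat) (r C : R) (a e : nat -> R) :
  0 <= r < 1 -> (forall n, 0 <= a n <= C) ->
  (forall n, (N0 <= n)%N -> a (n + K)%N <= r * a n + e n) ->
  e n @[n --> \oo] --> 0 -> a n @[n --> \oo] --> 0.
Proof.
move=> /andP[r0 r1] a0C aK e0.
apply/cvgrPdist_le => /= eps eps0.
have half0 : 0 < eps / 2 by rewrite divr_gt0.
have [N1 _ N1P] : \forall n \near \oo, e n <= (1 - r) * (eps / 2).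
  have /cvgrPdist_le /(_ ((1 - r) * (eps / 2))) := e0.
  rewrite mulr_gt0 ?subr_gt0// => /(_ isT); apply: filterS => n.
  by rewrite sub0r normrN; apply: le_trans; exact: ler_norm.
have claim j : \forall n \near \oo, a n <= r ^+ j * C + eps / 2.
  elim: j => [|j [N2 _ N2P]].
    apply: nearW => n; rewrite expr0 mul1r; case/andP: (a0C n) => _ h.
    by rewrite (le_trans h)// lerDl ltW.
  exists (maxn N0 (maxn N1 N2) + K)%N => // n /= nN.
  have Kn : (K <= n)%N by exact: leq_trans (leq_addl _ _) nN.
  rewrite -(subnK Kn).
  have : (maxn N0 (maxn N1 N2) <= n - K)%N by rewrite leq_subRL// addnC.
  rewrite !geq_max => /and3P[m0 m1 m2].
  apply: le_trans (aK _ m0) _; have := N1P _ m1; have := N2P _ m2 => /=.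
  move: (a (n - K)%N) (e (n - K)%N) => x y h1 h2.
  have h3 : r * x <= r * (r ^+ j * C + eps / 2) by rewrite ler_wpM2l.
  rewrite exprS; nra.
have [j rj] : exists j, r ^+ j * C <= eps / 2.
  have : (fun j => r ^+ j * C) @ \oo --> 0 * C.
    by apply: cvgMl; apply: cvg_expr; rewrite ger0_norm.
  rewrite mul0r => /cvgrPdist_le /(_ _ half0) [j _ /(_ j (leqnn j))] /=.
  by rewrite sub0r normrN => h; exists j; apply: le_trans h; exact: ler_norm.
have := claim j; apply: filterS => n h.
case/andP: (a0C n) => an0 _; rewrite sub0r normrN ger0_norm//.
lra.
Qed.

Section Stochastic.
Variables (R : realType) (K : nat).
Implicit Types (x y : 'rV[R]_K.+1) (P Q M : 'M[R]_K.+1).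

Definition l1norm x : R := \sum_k `|x 0 k|.

Lemma l1norm_ge0 x : 0 <= l1norm x.
Proof. exact: sumr_ge0. Qed.

Lemma l1normD x y : l1norm (x + y) <= l1norm x + l1norm y.
Proof.
by rewrite /l1norm -big_split; apply: ler_sum => k _; rewrite mxE ler_normD.
Qed.

Lemma l1norm_distribution x : is_distribution x -> l1norm x = 1.
Proof. by case=> x0 <-; apply: eq_bigr => k _; rewrite ger0_norm. Qed.

Lemma dTV_le_l1norm x y : dTV x y <= l1norm (x - y).
Proof.
apply: bigmax_le => [|A _]; first exact: l1norm_ge0.
rewrite -sumrB (le_trans (ler_norm_sum _ _ _))//.
rewrite [leRHS](bigID (mem A))/= -[leLHS]addr0 lerD ?sumr_ge0//.
by apply: ler_sum => k _; rewrite !mxE.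
Qed.

Lemma is_stochasticP P : is_stochastic P <->
  (forall i j, 0 <= P i j) /\ (forall i, \sum_j P i j = 1).
Proof.
split=> [sP|[P0 P1] i]; first split=> i.
- by move=> j; case: (sP i) => /(_ j); rewrite mxE.
- by case: (sP i) => _ <-; apply: eq_bigr => j _; rewrite mxE.
- by split=> [j|]; rewrite ?mxE// -(P1 i); apply: eq_bigr => j _; rewrite mxE.
Qed.

Lemma stochastic1 : is_stochastic (1 : 'M[R]_K.+1).
Proof.
apply/is_stochasticP; split=> [i j|i].
  by rewrite mxE; case: (_ == _).
under eq_bigr do rewrite mxE.
by rewrite (bigD1 i)//= eqxx big1 ?addr0// => j; rewrite eq_sym => /negPf ->.
Qed.

Lemma stochasticM P Q : is_stochastic P -> is_stochastic Q -> is_stochastic (P * Q).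
Proof.
move=> /is_stochasticP[P0 P1] /is_stochasticP[Q0 Q1]; apply/is_stochasticP.
split=> [i j|i]; first by rewrite mxE sumr_ge0// => k _; rewrite mulr_ge0.
under eq_bigr do rewrite mxE.
rewrite exchange_big/= -[RHS](P1 i); apply: eq_bigr => k _.
by rewrite -mulr_sumr Q1 mulr1.
Qed.

Lemma stochastic_prod (M : nat -> 'M[R]_K.+1) m n :
  (forall k, (m <= k < n)%N -> is_stochastic (M k)) ->
  is_stochastic (\prod_(m <= k < n) M k).
Proof.
move=> sM; rewrite big_nat; apply: (big_ind (@is_stochastic R K)) => //.
- exact: stochastic1.
- exact: stochasticM.
Qed.

Lemma l1norm_mulmx_le x P : is_stochastic P -> l1norm (x *m P) <= l1norm x.
Proof.
move=> /is_stochasticP[P0 P1]; rewrite /l1norm.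
apply: (@le_trans _ _ (\sum_j \sum_k `|x 0 k| * P k j)).
  apply: ler_sum => j _; rewrite mxE (le_trans (ler_norm_sum _ _ _))//.
  by apply: ler_sum => k _; rewrite normrM [`|P k j|]ger0_norm.
rewrite exchange_big/=; apply: ler_sum => k _.
by rewrite -mulr_sumr P1 mulr1.
Qed.

(** Doeblin's minorization: as [x] has zero mass, subtracting the constant [eps]
    from column [j0] does not change [x *m P], and what remains of [P] is
    nonnegative with row sums [1 - eps]. *)
Lemma l1norm_doeblin x P j0 eps : is_stochastic P ->
  (forall i, eps <= P i j0) -> \sum_k x 0 k = 0 ->
  l1norm (x *m P) <= (1 - eps) * l1norm x.
Proof.
move=> /is_stochasticP[P0 P1] Pe x0; rewrite /l1norm.
pose Q k j := P k j - (if j == j0 then eps else 0).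
have Q0 k j : 0 <= Q k j.
  by rewrite /Q; case: eqP => [->|_]; rewrite ?subr0// subr_ge0.
have Q1 k : \sum_j Q k j = 1 - eps.
  by rewrite sumrB P1 -big_mkcond big_pred1_eq.
apply: (@le_trans _ _ (\sum_j \sum_k `|x 0 k| * Q k j)).
  apply: ler_sum => j _; rewrite mxE.
  have -> : \sum_k x 0 k * P k j = \sum_k x 0 k * Q k j.
    under [RHS]eq_bigr do rewrite mulrBr.
    by rewrite sumrB -mulr_suml x0 mul0r subr0.
  rewrite (le_trans (ler_norm_sum _ _ _))//.
  by apply: ler_sum => k _; rewrite normrM [`|Q k j|]ger0_norm.
rewrite exchange_big/= mulr_sumr; apply: ler_sum => k _.
by rewrite -mulr_sumr Q1 mulrC.
Qed.

Lemma cvg_sum0 (I : finType) (f : I -> nat -> R) :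
  (forall i, f i n @[n --> \oo] --> 0) -> \sum_i f i n @[n --> \oo] --> 0.
Proof.
move=> fi; rewrite -[X in _ --> X](@big1 _ _ +%R I (index_enum I) xpredT (fun=> 0))//.
by apply: cvg_big => [|i _]; [exact: add_continuous|exact: fi].
Qed.

(** Every state reaches [0] within [L >= i] steps by moving down, waiting at [0]
    when it arrives early; each of these moves has probability at least [c]. *)
Lemma prod_minor (M : nat -> 'M[R]_K.+1) (c : R) : 0 <= c ->
  (forall n, (1 <= n)%N -> is_stochastic (M n)) ->
  (forall n (i j : 'I_K.+1), (1 <= n)%N -> j = i.-1 :> nat -> c <= M n i j) ->
  forall L n (i : 'I_K.+1), (1 <= n)%N -> (i <= L)%N ->
    c ^+ L <= (\prod_(n <= k < n + L) M k) i ord0.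
Proof.
move=> c0 sM cM; elim=> [|L IH] n i n1 iL.
  rewrite addn0 big_geq// mxE expr0 (_ : i = ord0) ?eqxx//.
  by apply/val_inj/eqP; rewrite /= -leqn0.
rewrite big_ltn ?addnS ?ltnS ?leq_addr// -addSn mxE.
have iK : (i.-1 < K.+1)%N by rewrite (leq_ltn_trans (leq_pred _)).
rewrite (bigD1 (Ordinal iK))//= exprS.
rewrite -[leLHS]addr0 lerD//.
  rewrite ler_pM ?exprn_ge0//; first exact: cM.
  by apply: IH => //=; lia.
apply: sumr_ge0 => k _; rewrite mulr_ge0//.
  by have /is_stochasticP[h _] := sM n n1; exact: h.
have /is_stochasticP[h _] : is_stochastic (\prod_(n.+1 <= k0 < n.+1 + L) M k0).
  by apply: stochastic_prod => m /andP[nm _]; apply: sM; lia.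
exact: h.
Qed.

(** Convergence to [pi] of a nonhomogeneous product needs two ingredients: every
    block of [L] factors puts mass at least [eps] on state [0], and [pi] is
    asymptotically invariant under one step. *)
Section Ergodic.
Variables (M : nat -> 'M[R]_K.+1) (L : nat) (eps : R) (pi : 'rV[R]_K.+1).
Hypotheses (sM : forall n, (1 <= n)%N -> is_stochastic (M n))
  (eps0 : 0 < eps <= 1) (dpi : is_distribution pi)
  (minor : forall n i, (1 <= n)%N -> eps <= (\prod_(n <= k < n + L) M k) i ord0)
  (piM : l1norm (pi *m M n - pi) @[n --> \oo] --> 0).

(** Passing from [j] to [j.+1] factors adds the one-step defect of [pi], and a
    stochastic matrix does not increase the l1 norm. *)
Lemma stationary_defect_cvg0 j :
  l1norm (pi *m \prod_(n <= k < n + j) M k - pi) @[n --> \oo] --> 0.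
Proof.
elim: j => [|j IH].
  under eq_fun => n do rewrite addn0 big_geq// mulmx1 subrr.
  rewrite (_ : l1norm 0 = 0); first exact: cvg_cst.
  by rewrite /l1norm big1// => k _; rewrite mxE normr0.
apply: (@squeeze_cvgr _ _ _ _ (fun=> 0)
  (fun n => l1norm (pi *m \prod_(n <= k < n + j) M k - pi) +
            l1norm (pi *m M (n + j)%N - pi))).
- near=> n.
  have n1 : (1 <= n)%N by near: n; exact: nbhs_infty_ge.
  rewrite l1norm_ge0/= addnS big_nat_recr ?leq_addr//=.
  set A := \prod_(n <= k < n + j) M k; set B := M (n + j)%N.
  have -> : pi *m (A * B) - pi = (pi *m A - pi) *m B + (pi *m B - pi).
    by rewrite mulmxBl -mulmxA mulmxE addrA subrK.
  apply: le_trans (l1normD _ _) _; rewrite lerD2r l1norm_mulmx_le//.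
  by apply: sM; rewrite (leq_trans n1)// leq_addr.
- exact: cvg_cst.
- rewrite -[X in _ --> X]addr0; apply: cvgD => //.
  by have := piM; rewrite -(cvg_shiftn j).
Unshelve. all: by end_near. Qed.

(** With [A] the product up to time [n] and [B] the next [L] factors,
      [row i (A * B) - pi = (row i A - pi) *m B + (pi *m B - pi)];
    the first term is contracted by [1 - eps], the second one tends to zero. *)
Lemma row_prod_cvg m i : (1 <= m)%N ->
  l1norm (row i (\prod_(m <= k < n) M k) - pi) @[n --> \oo] --> 0.
Proof.
move=> m1; case/andP: eps0 => e0 e1.
have sP n : is_stochastic (\prod_(m <= k < n) M k).
  by apply: stochastic_prod => k /andP[mk _]; apply: sM; exact: leq_trans mk.
apply: (@cvg0_delayed_contraction _ m L (1 - eps) 2 _ _ _ _ _ (stationary_defect_cvg0 L)).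
- by rewrite subr_ge0 e1 gtrBl e0.
- move=> n; rewrite l1norm_ge0/=; apply: le_trans (l1normD _ _) _.
  rewrite (l1norm_distribution _ (sP n i)).
  rewrite (_ : l1norm (- pi) = 1) ?(natrD _ 1 1)// -(l1norm_distribution _ dpi).
  by apply: eq_bigr => k _; rewrite mxE normrN.
- move=> n mn /=; have n1 := leq_trans m1 mn.
  rewrite (@big_cat_nat _ _ _ n)//= ?leq_addr//.
  set A := \prod_(m <= k < n) M k; set B := \prod_(n <= k < n + L) M k.
  have sB : is_stochastic B.
    by apply: stochastic_prod => k /andP[nk _]; apply: sM; exact: leq_trans nk.
  have -> : row i (A * B) - pi = (row i A - pi) *m B + (pi *m B - pi).
    by rewrite mulmxBl -row_mul mulmxE addrA subrK.
  apply: le_trans (l1normD _ _) _; rewrite lerD2r.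
  apply: l1norm_doeblin => //; first by move=> k; exact: minor.
  under eq_bigr do rewrite mxE.
  rewrite big_split/=; case: (sP n i) => _ ->.
  under eq_bigr do rewrite mxE.
  by rewrite sumrN; case: dpi => _ ->; rewrite subrr.
Qed.

(** [eta *m P - pi] is the combination of the rows [row i P - pi] with weights
    [eta 0 i <= 1], so the sum over [i] of their l1 norms bounds the total
    variation distance for all [eta] at once. *)
Lemma strongly_ergodic_minorized : strongly_ergodic M pi.
Proof.
move=> m m1.
pose g n := \sum_i l1norm (row i (\prod_(m <= k < n) M k) - pi).
have g0 : g n.+1 @[n --> \oo] --> 0.
  rewrite (cvg_shiftS g); apply: cvg_sum0 => i; exact: row_prod_cvg.
have gP n eta : is_distribution eta -> dTV (eta *m \prod_(m <= i < n) M i) pi <= g n.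
  move=> [eta0 eta1]; apply: le_trans (dTV_le_l1norm _ _) _.
  set P := \prod_(_ <= _ < _) _.
  have -> : eta *m P - pi = \sum_i eta 0 i *: (row i P - pi).
    under eq_bigr do rewrite scalerBr.
    rewrite sumrB -scaler_suml eta1 scale1r; congr (_ - _).
    by rewrite mulmx_sum_row.
  rewrite /g /l1norm.
  apply: (@le_trans _ _ (\sum_k \sum_i `|(row i P - pi) 0 k|)); last first.
    by rewrite exchange_big.
  apply: ler_sum => k _; rewrite summxE (le_trans (ler_norm_sum _ _ _))//.
  apply: ler_sum => i _; rewrite mxE normrM ler_piMl// ger0_norm//.
  by rewrite -eta1 (bigD1 i)//= lerDl sumr_ge0.
apply: (@squeeze_cvgr _ _ _ _ (fun=> 0) (fun n => g n.+1)) => //; last exact: cvg_cst.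
apply: nearW => n; set A := [set _ | _ in _].
have A1 : A (dTV (pi *m \prod_(m <= i < n.+1) M i) pi) by exists pi.
have gA : ubound A (g n.+1) by move=> _ [eta de <-]; exact: gP.
apply/andP; split; last by apply: ge_sup => //; eexists; exact: A1.
apply: le_trans (ub_le_sup (ex_intro _ _ gA) A1).
by rewrite /dTV; exact: bigmax_ge_id.
Qed.

End Ergodic.
End Stochastic.

Arguments l1norm {R K} x.

(** * The buffer matrix *)

Lemma sum_ord_single (R : realType) (n a : nat) (x : R) :
  \sum_(j < n) (if j == a :> nat then x else 0) = if (a < n)%N then x else 0.
Proof.
case: ltnP => an; last first.
  by rewrite big1// => j _; case: eqP => // ja; rewrite leqNgt -ja ltn_ord in an.
by rewrite (bigD1 (Ordinal an))//= eqxx big1 ?addr0// => j; rewrite -val_eqE/= => /negPf ->.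
Qed.

Section Buffer.
Variables (R : realType) (K : nat) (p : R).
Hypothesis p01 : 0 < p < 1.
Let p0 : 0 < p. Proof. by case/andP: p01. Qed.
Let p1 : 0 < 1 - p. Proof. by rewrite subr_gt0; case/andP: p01. Qed.

Lemma buffer_matrix_row_sum (u : R) i : \sum_j buffer_matrix K p u i j = 1.
Proof.
set up := up_rate K p u i; set dn := down_rate K p u i.
(* The guard [0 < i] matters: for [i = 0] the index [i.-1] is [0] again. *)
transitivity (\sum_(j < K.+1) ((if j == i.+1 :> nat then up else 0) +
    (if (0 < i)%N && (j == i.-1 :> nat) then dn else 0) +
    (if j == i :> nat then 1 - up - dn else 0))).
  apply: eq_bigr => j _; rewrite mxE -/up -/dn.
  rewrite -[i == j]/(val i == val j) /=.
  case: (ltngtP j i) => ij.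
  - rewrite (_ : (j == i.+1 :> nat) = false); last by apply/eqP; lia.
    rewrite (leq_ltn_trans (leq0n _) ij)/= add0r addr0.
    rewrite (_ : (i == j.+1 :> nat) = (j == i.-1 :> nat)); last by lia.
    by case: ifP.
  - rewrite (_ : (i == j.+1 :> nat) = false); last by apply/eqP; lia.
    rewrite (_ : (j == i.-1 :> nat) = false); last by apply/eqP; lia.
    by rewrite andbF !addr0.
  - rewrite (_ : (j == i.+1 :> nat) = false); last by apply/eqP; lia.
    rewrite (_ : (i == j.+1 :> nat) = false); last by apply/eqP; lia.
    rewrite (_ : (0 < i)%N && (j == i.-1 :> nat) = false); last by lia.
    by rewrite !add0r.
rewrite !big_split/= !sum_ord_single ltn_ord.
have -> : (if (i.+1 < K.+1)%N then up else 0) = up.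
  by rewrite /up /up_rate ltnS; case: ltnP.
have -> : \sum_(j < K.+1)
    (if (0 < i)%N && (j == i.-1 :> nat) then dn else 0) = dn.
  case: ltnP => /= i0.
    by rewrite sum_ord_single ifT// (leq_ltn_trans (leq_pred _)).
  by rewrite big1// /dn /down_rate; move: i0; rewrite leqn0 => ->.
by ring.
Qed.

Lemma buffer_stochastic (u : R) : 0 < u < 1 -> is_stochastic (buffer_matrix K p u).
Proof.
move=> /andP[u0 u1]; apply/is_stochasticP; split; last exact: buffer_matrix_row_sum.
have pu : 0 <= (1 - p) * u by rewrite mulr_ge0// ltW.
have pu' : 0 <= p * (1 - u) by rewrite mulr_ge0 ?subr_ge0// ltW.
move=> i j; rewrite mxE /up_rate /down_rate.
case: ifP => _; first by case: ifP.
case: ifP => _; first by case: ifP => // _; case: ifP => // _; exact: ltW.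
case: ifP => // _.
have ppu : 0 <= p * u by rewrite mulr_ge0// ltW.
have qqu : 0 <= (1 - p) * (1 - u) by rewrite mulr_ge0 ?(ltW p1)// subr_ge0 ltW.
case: ltnP => _; case: ifP => _; move: pu pu' ppu qqu u0 u1 p0 p1; lra.
Qed.

(** Only neighbouring states matter, and there balance is the identity
    [p * (1 - u) = b * ((1 - p) * u)]; at the top state the factor [1 - p] of
    [pi] compensates the larger downward rate [u]. *)
Lemma buffer_detailed_balance (u : R) (pi : 'rV[R]_K.+1) (c : R) : 0 < u ->
  (forall k : 'I_K.+1, pi 0 k = c * (if (k < K)%N then rate_ratio p u ^+ k
     else (1 - p) * rate_ratio p u ^+ K)) ->
  forall i j, pi 0 i * buffer_matrix K p u i j = pi 0 j * buffer_matrix K p u j i.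
Proof.
move=> u0 piE.
have un0 : u != 0 by rewrite gt_eqF.
have pn0 : 1 - p != 0 by rewrite gt_eqF.
suff up (i j : 'I_K.+1) : j = i.+1 :> nat ->
    pi 0 i * buffer_matrix K p u i j = pi 0 j * buffer_matrix K p u j i.
  move=> i j; have [ij|ij|ij] := ltngtP i j; last by move/val_inj: ij => ->.
  - have [|ji] := eqVneq (val j) i.+1; first exact: up.
    have e1 : (i == j.+1 :> nat) = false by lia.
    have e2 : (i == j) = false by rewrite -val_eqE/=; lia.
    by rewrite !mxE (negPf ji) e1 [j == i]eq_sym e2 !mulr0.
  - have [ji|ji] := eqVneq (val i) j.+1; first by rewrite -up.
    have e1 : (j == i.+1 :> nat) = false by lia.
    have e2 : (i == j) = false by rewrite -val_eqE/=; lia.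
    by rewrite !mxE (negPf ji) e1 [j == i]eq_sym e2 !mulr0.
move=> ji; rewrite !mxE ji eqxx ifF; last by apply/eqP; lia.
have iK : (i < K)%N by have := ltn_ord j; rewrite ji ltnS.
rewrite !piE iK ji /up_rate /down_rate iK/=.
have bE : p * (1 - u) = rate_ratio p u * ((1 - p) * u).
  by rewrite /rate_ratio; field; rewrite un0.
rewrite bE; case: ltnP => iK1; first by rewrite exprS; ring.
have -> : rate_ratio p u ^+ K = rate_ratio p u ^+ i.+1.
  by congr (_ ^+ _); lia.
by rewrite exprS; ring.
Qed.

Lemma buffer_stationary (u : R) (pi : 'rV[R]_K.+1) (c : R) : 0 < u ->
  (forall k : 'I_K.+1, pi 0 k = c * (if (k < K)%N then rate_ratio p u ^+ k
     else (1 - p) * rate_ratio p u ^+ K)) ->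
  pi *m buffer_matrix K p u = pi.
Proof.
move=> u0 piE; apply/rowP => j; rewrite mxE.
under eq_bigr do rewrite (buffer_detailed_balance u pi c u0 piE).
by rewrite -mulr_sumr buffer_matrix_row_sum mulr1.
Qed.

Lemma buffer_matrix_cvg (u : nat -> R) (l : R) i j : u n @[n --> \oo] --> l ->
  buffer_matrix K p (u n) i j @[n --> \oo] --> buffer_matrix K p l i j.
Proof.
move=> ul; rewrite mxE; under eq_fun do rewrite mxE.
have cup : up_rate K p (u n) i @[n --> \oo] --> up_rate K p l i.
  rewrite /up_rate; case: ifP => _; last exact: cvg_cst.
  by apply: cvgMr; apply: cvgB => //; exact: cvg_cst.
have cdn : down_rate K p (u n) i @[n --> \oo] --> down_rate K p l i.
  rewrite /down_rate; case: ifP => _; first exact: cvg_cst.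
  by case: ifP => _ //; exact: cvgMr.
case: ifP => _ //; case: ifP => _ //; case: ifP => _; last exact: cvg_cst.
by apply: cvgB => //; apply: cvgB => //; exact: cvg_cst.
Qed.

Lemma buffer_defect_cvg0 (u : nat -> R) (l : R) (pi : 'rV[R]_K.+1) :
  u n @[n --> \oo] --> l -> pi *m buffer_matrix K p l = pi ->
  l1norm (pi *m buffer_matrix K p (u n) - pi) @[n --> \oo] --> 0.
Proof.
move=> ul piE; apply: cvg_sum0 => k.
have h : (pi *m buffer_matrix K p (u n)) 0 k @[n --> \oo] --> pi 0 k.
  rewrite -[X in _ --> (X : 'rV_ _) 0 k]piE mxE; under eq_fun do rewrite mxE.
  apply: cvg_big => [|i _]; first exact: add_continuous.
  by apply: cvgMr; exact: buffer_matrix_cvg.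
have : `|(pi *m buffer_matrix K p (u n)) 0 k - pi 0 k| @[n --> \oo]
    --> `|pi 0 k - pi 0 k|.
  by apply: cvg_norm; apply: cvgB => //; exact: cvg_cst.
rewrite subrr normr0; apply: cvg_trans; apply: near_eq_cvg; apply: nearW => n.
by rewrite !mxE.
Qed.

(** The move goes one state down, or stays at [0] as [0.-1 = 0]; it is the
    move used in the minorization of products. *)
Lemma buffer_drain (u c : R) : (1 <= K)%N -> c <= u -> 0 < u < 1 -> c <= 1 ->
  forall i j : 'I_K.+1, j = i.-1 :> nat ->
    (1 - p) * c <= buffer_matrix K p u i j.
Proof.
move=> K1 cu /andP[u0 u1] c1 i j ji; rewrite mxE.
have pc : (1 - p) * c <= (1 - p) * u by rewrite ler_wpM2l// ltW.
have pu : (1 - p) * u <= u by rewrite ler_piMl ?(ltW u0)// gerBl ltW.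
have -> : (j == i.+1 :> nat) = false by lia.
have [i0|i0] := posnP i.
  have -> : (i == j.+1 :> nat) = false by lia.
  have -> : (i == j) = true by rewrite -val_eqE/=; lia.
  rewrite /up_rate /down_rate i0 K1 eqxx subr0.
  have : 0 <= p * u by rewrite mulr_ge0// ltW.
  have : (1 - p) * c <= (1 - p) * 1 by rewrite ler_wpM2l// ltW.
  lra.
have -> : (i == j.+1 :> nat) = true by lia.
rewrite /down_rate gt_eqF//; case: ifP => // _.
exact: le_trans pu.
Qed.

End Buffer.

(** * The law of a Markov chain *)

Section Markov.
Variables (R : realType) (K : nat) (d : measure_display) (Omega : measurableType d)
  (P : probability Omega R) (B : nat -> Omega -> 'I_K.+1).

Lemma probability_split (X : Omega -> 'I_K.+1) (A : set Omega) :
  (forall k, measurable (X @^-1` [set k])) -> measurable A ->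
  P A = (\sum_k P (A `&` X @^-1` [set k]))%E.
Proof.
move=> mX mA; rewrite -measure_bigsetU_ord.
- congr (P _); apply/seteqP; split=> [y Ay|].
    by rewrite (bigD1 (X y))//=; left.
  apply: (big_ind (fun S => S `<=` A)) => [//|S S' SA S'A y|k _ y []//].
  by move=> [/SA|/S'A].
- by move=> k; exact: measurableI.
- by move=> i j _ _ [y [[_ <-] [_ <-]]].
Qed.

Definition path_event (j n : nat) (x : nat -> 'I_K.+1) : set Omega :=
  [set o | forall i, (j <= i <= n)%N -> B i o = x i].

Variables (x0 : 'I_K.+1) (M : nat -> 'M[R]_K.+1).
Hypothesis chain : is_markov_chain P B x0 M.

Let mB n k : measurable (B n @^-1` [set k]).
Proof. by case: chain. Qed.

Lemma measurable_path_event j n x : measurable (path_event j n x).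
Proof.
have -> : path_event j n x =
    \bigcap_(i in [set i | (j <= i <= n)%N]) (B i @^-1` [set x i]).
  by apply/seteqP; split.
by apply: bigcap_measurableType.
Qed.

Lemma path_event_split j n x : (j <= n)%N ->
  P (path_event j.+1 n x) =
  (\sum_k P (path_event j n (fun i => if i == j then k else x i)))%E.
Proof.
move=> jn; rewrite (probability_split (B j))//; last exact: measurable_path_event.
apply: eq_bigr => k _; congr (P _); apply/seteqP; split=> o /=.
  move=> [h1 h2] i /andP[ji iN]; case: eqP => [->//|/eqP ij].
  by apply: h1; rewrite iN andbT ltn_neqAle eq_sym ij.
move=> h; split; last by rewrite h ?leqnn// eqxx.
by move=> i /andP[ji iN]; rewrite h ?iN ?(ltnW ji)// gtn_eqF.
Qed.

(** The product form of the Markov property fixes the whole history from time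
    [0]; summing over the state at time [j] forgets that time, so induction on
    [j] removes the history one step after the other. *)
Lemma markov_step j n x : (j <= n)%N ->
  P (path_event j n.+1 x) = (P (path_event j n x) * (M n.+1 (x n) (x n.+1))%:E)%E.
Proof.
elim: j x => [|j IH] x jn.
  by case: chain => _ _ /(_ n x).
have jn' := ltnW jn.
rewrite !path_event_split ?(leqW jn')// ge0_sume_distrl; last by move=> k _.
by apply: eq_bigr => k _; rewrite IH// !gtn_eqF.
Qed.

Lemma law_step n : law P (B n.+1) = law P (B n) *m M n.+1.
Proof.
apply/rowP => l; rewrite !mxE.
rewrite (probability_split (B n))//.
pose x k := fun i : nat => if i == n then k else l.
transitivity (fine (\sum_k (fine (P (B n @^-1` [set k])) * M n.+1 k l)%:E)%E).
  congr fine; apply: eq_bigr => k _.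
  have -> : B n.+1 @^-1` [set l] `&` B n @^-1` [set k] =
      path_event n n.+1 (x k).
    apply/seteqP; split=> o /=.
      move=> [h1 h2] i; rewrite -ltnS => /andP[ni iN]; rewrite /x.
      case: eqP => [->//|ni']; have -> // : i = n.+1.
      by lia.
    by move=> h; rewrite !h ?leqnn ?leqnSn// /x eqxx gtn_eqF.
  rewrite markov_step// EFinM fineK ?fin_num_measure//.
  congr (P _ * _)%E; last by rewrite /x eqxx gtn_eqF.
  apply/seteqP; split=> o /=; first by move/(_ n); rewrite leqnn /x eqxx; exact.
  move=> h i /andP[h1 h2]; have -> : i = n by lia.
  by rewrite /x eqxx.
by rewrite sumEFin /=; apply: eq_bigr => k _; rewrite mxE.
Qed.
End Markov.

Theorem theorem1 (R : realType) (T mu sigma2 kappa delta w : R)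
    (hT : 0 < T) (hmu : 0 < mu) (hsigma2 : 0 <= sigma2) (hkappa : 0 <= kappa)
    (hdelta : 1 < delta) (hw : 0 < w)
    (K : nat) (hK : (1 <= K)%N) (p : R) (hp : 0 < p < 1) :
  let U := cond_coverage T mu sigma2 kappa delta w in
  let q := activity K p U in
  let M := buffer_trans K p U in
  let qstar := lim (q n @[n --> \oo]) in
  let pi := buffer_limit K p U qstar in
  [/\ q n @[n --> \oo] --> qstar,
      minimal_fixpoint (Ffun K p U) p 1 qstar,
      is_distribution pi,
      (forall n, (1 <= n)%N -> is_stochastic (M n))
      /\ strongly_ergodic M pi
    & forall (d : measure_display) (Omega : measurableType d)
        (P : probability Omega R) (B : nat -> Omega -> 'I_K.+1),
        is_markov_chain P B ord0 M ->
        forall n, (1 <= n)%N -> law P (B n) = law P (B n.-1) *m M n].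
Proof.
move=> U q M qstar pi.
have U01 x : 0 < x -> 0 < U x < 1.
  by move=> x0; rewrite cond_coverage_gt0 ?cond_coverage_lt1.
have Unincr x y : 0 < x -> x <= y -> U y <= U x by exact: cond_coverage_nincr.
have Ulip x y : 0 < x -> x <= y -> U x <= U y + (y - x) / x by exact: cond_coverage_lip.
have [p0 p1] := andP hp.
have p1' : 0 < 1 - p by rewrite subr_gt0.
have q0 n : 0 < q n by exact: activity_gt0.
have qU n : 0 < U (q n) < 1 by exact: U01.
have qs0 : 0 < qstar.
  by apply: lt_trans (activity_lim_gt R K p hK hp U U01 Unincr).
have sM n : (1 <= n)%N -> is_stochastic (M n) by move=> _; exact: buffer_stochastic.
have [U0 U1] := andP (U01 _ qs0).
have b0 : 0 < rate_ratio p (U qstar) by apply: rate_ratio_gt0 => //; exact: U01.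
have piE (k : 'I_K.+1) : pi 0 k = (occupancy_sum K p (rate_ratio p (U qstar)))^-1 *
    (if (k < K)%N then rate_ratio p (U qstar) ^+ k
     else (1 - p) * rate_ratio p (U qstar) ^+ K).
  rewrite /pi mxE -(empty_prob_lim R K p hK hp U U01 Unincr Ulip) -/q -/qstar.
  by case: ifP => _; rewrite mulrC.
have S0 : 0 < occupancy_sum K p (rate_ratio p (U qstar)).
  by apply: lt_trans ltr01 _; exact: occupancy_sum_gt1.
have dpi : is_distribution pi.
  split=> [k|].
    rewrite piE mulr_ge0 ?invr_ge0 ?(ltW S0)//.
    by case: ifP => _; rewrite ?mulr_ge0 ?exprn_ge0 ?(ltW p1') ?(ltW b0).
  under eq_bigr do rewrite piE.
  rewrite -mulr_sumr big_ord_recr/= ltnn.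
  under eq_bigr => i _ do rewrite /= ltn_ord.
  by rewrite mulVf// gt_eqF.
have piM : l1norm (pi *m M n - pi) @[n --> \oo] --> 0.
  apply: (buffer_defect_cvg0 R K p (fun n => U (q n)) (U qstar)).
    exact: (cond_activity_cvg R K p hK hp U).
  exact: (buffer_stationary R K p hp _ _ _ U0 piE).
split.
- exact: activity_cvg.
- exact: activity_lim_minimal.
- exact: dpi.
- split; first exact: sM.
  have [V0 V1] := andP (U01 _ ltr01).
  (* All iterates are at most [1] and [U] is nonincreasing, hence [U 1] bounds
     the service probabilities from below uniformly in time. *)
  pose c := (1 - p) * U 1.
  have c0 : 0 < c by rewrite mulr_gt0.
  have c1 : c <= 1 by rewrite mulr_ile1 ?(ltW p1') ?(ltW V0) ?(ltW V1)// gerBl ltW.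
  apply: (strongly_ergodic_minorized _ _ _ K (c ^+ K)) => //.
    by rewrite exprn_gt0 ?exprn_ile1// ltW.
  move=> n i n1; apply: (prod_minor R K M c) => //; first exact: ltW.
    move=> m a b m1 ab; apply: buffer_drain => //; last exact: ltW.
    apply: Unincr => //.
    by case/andP: (activity_bounds R K p hK hp U U01 m) => _ /ltW.
  by rewrite -ltnS.
- by move=> d Omega P B chain [|n]// _; exact: law_step chain n.
Qed.
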